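(* For all integers $m\geq 1$ and $n\geq 1$, the graph $m\Gamma(\mathbb{Z}_6)+n\Gamma(\mathbb{Z}_9)$ (the join of $m\Gamma(\mathbb{Z}_6)$ and $n\Gamma(\mathbb{Z}_9)$) does not admit a distance antimagic labeling.
   Context: For an integer $n \geq 2$, the zero-divisor graph $\Gamma(\mathbb{Z}_n)$ is the simple graph whose vertex set is the set of nonzero zero-divisors of the ring $\mathbb{Z}_n$, two distinct vertices $u,v$ being adjacent iff $uv \equiv 0 \pmod n$. For a graph $H$ and positive integer $k$, $kH$ denotes the disjoint union of $k$ copies of $H$. For graphs $G,H$, the join $G+H$ is the graph obtained from the disjoint union of $G$ and $H$ by adding every edge between a vertex of $G$ and a vertex of $H$. A distance antimagic labeling (DAML) of a graph $G$ with $N$ vertices is a bijection $f:V(G)\to\{1,\dots,N\}$ such that the weights $w(v)=\sum_{u\in N(v)} f(u)$, where $N(v)$ is the open neighbourhood of $v$, are pairwise distinct over all vertices $v$. A graph admits DAML if such a labeling exists. *)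

(* Defs.v *)
From mathcomp Require Import all_boot all_order all_algebra.

Set Implicit Arguments.
Unset Strict Implicit.
Unset Printing Implicit Defensive.

Record sgraph : Type := SGraph {
  vertex :> finType;
  adj : rel vertex;
  adj_sym : symmetric adj;
  adj_irrefl : irreflexive adj }.

Section ZeroDivisorGraph.
Import GRing.Theory.
Local Open Scope ring_scope.

Variable n : nat.

Definition nz_zero_divisor : pred 'Z_n :=
  fun x => (x != 0) && [exists y : 'Z_n, (y != 0) && (x * y == 0)].

Definition zd_vertex : finType := {x : 'Z_n | nz_zero_divisor x}.

Definition zd_adj : rel zd_vertex :=
  fun u v => (u != v) && (val u * val v == 0).

Lemma zd_adj_sym : symmetric zd_adj.
Proof. by move=> u v; rewrite /zd_adj eq_sym mulrC. Qed.

Lemma zd_adj_irrefl : irreflexive zd_adj.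
Proof. by move=> u; rewrite /zd_adj eqxx. Qed.

(* This is the zero-divisor graph of Z/nZ only for 1 < n: MathComp's 'Z_0 and
   'Z_1 both denote Z/2Z. *)
Definition zd_graph : sgraph := SGraph zd_adj_sym zd_adj_irrefl.

End ZeroDivisorGraph.

Section Copies.
Variables (k : nat) (G : sgraph).

Definition copies_adj : rel ('I_k * G)%type :=
  fun u v => (u.1 == v.1) && adj u.2 v.2.

Lemma copies_adj_sym : symmetric copies_adj.
Proof. by move=> u v; rewrite /copies_adj eq_sym adj_sym. Qed.

Lemma copies_adj_irrefl : irreflexive copies_adj.
Proof. by move=> u; rewrite /copies_adj adj_irrefl andbF. Qed.

Definition copies : sgraph := SGraph copies_adj_sym copies_adj_irrefl.

End Copies.

Section Join.
Variables G H : sgraph.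

Definition join_adj : rel (G + H)%type := fun u v =>
  match u, v with
  | inl x, inl y => adj x y
  | inr x, inr y => adj x y
  | _, _ => true
  end.

Lemma join_adj_sym : symmetric join_adj.
Proof. by move=> [x|x] [y|y] //=; rewrite adj_sym. Qed.

Lemma join_adj_irrefl : irreflexive join_adj.
Proof. by move=> [x|x] /=; rewrite adj_irrefl. Qed.

Definition join : sgraph := SGraph join_adj_sym join_adj_irrefl.

End Join.

Section DistanceAntimagic.
Variable G : sgraph.

Definition open_nbhd (v : G) : {set G} := [set u | adj v u].

Definition weight (f : G -> nat) (v : G) : nat := \sum_(u in open_nbhd v) f u.

(* The first two conjuncts say that f is a bijection from the vertices onto
   {1, ..., #|G|}. *)
Definition distance_antimagic (f : G -> nat) : Prop :=
  [/\ injective f,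
      forall k : nat, (exists v : G, f v = k) <-> 1 <= k <= #|G|
    & injective (weight f)].

Definition admits_daml : Prop := exists f : G -> nat, distance_antimagic f.

End DistanceAntimagic.

(* Main.v *)
Require Import Defs.
From mathcomp Require Import all_boot all_order all_algebra.

(** In Γ(Z_6), which is the path 2 - 3 - 4, the vertices 2 and 4 have the same
    open neighbourhood. Disjoint copies and joins preserve such twins, and twins
    have equal weights under every labeling. *)

Definition twins (G : sgraph) (u v : G) : Prop := adj u =1 adj v.

Lemma twins_no_daml (G : sgraph) (u v : G) :
  u != v -> twins G u v -> ~ admits_daml G.
Proof.
move=> neq_uv tw [f [_ _ inj_w]]; case/eqP: neq_uv; apply: inj_w.
by apply: eq_bigl => x; rewrite !inE tw.
Qed.

(** Both vertices lie in copy [i], so the index test has the same outcome for each. *)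
Lemma copies_twins (k : nat) (G : sgraph) (i : 'I_k) (u v : G) :
  twins G u v -> twins (copies k G) (i, u) (i, v).
Proof. by move=> tw [j x]; rewrite /= /copies_adj /= tw. Qed.

Lemma join_twins_l (G H : sgraph) (u v : G) :
  twins G u v -> twins (join G H) (inl u) (inl v).
Proof. by move=> tw [x|x] //=; apply: tw. Qed.

Lemma zd6_two : nz_zero_divisor (inZp 2 : 'Z_6).
Proof. by apply/andP; split=> //; apply/existsP; exists (inZp 3). Qed.

Lemma zd6_four : nz_zero_divisor (inZp 4 : 'Z_6).
(* 4 * 3 = 12 vanishes mod 6. *)
Proof. by apply/andP; split=> //; apply/existsP; exists (inZp 3). Qed.

Lemma zd6_twins :
  twins (zd_graph 6) (exist _ (inZp 2) zd6_two) (exist _ (inZp 4) zd6_four).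
Proof.
(* Residue by residue: 2x and 4x vanish mod 6 for the same x, namely 0 and 3; [ltx] excludes x >=
   6. *)
by case=> [[[|[|[|[|[|[|x]]]]]] ltx] px].
Qed.

Theorem theorem2p6 (m n : nat) (hm : 1 <= m) (hn : 1 <= n) :
  ~ admits_daml (join (copies m (zd_graph 6)) (copies n (zd_graph 9))).
Proof.
(* [hm] unfolds to [0 < m], so [Ordinal hm] is the index 0: the twins are taken in the first
   copy. *)
apply: twins_no_daml (join_twins_l _ _ _ _
  (copies_twins m _ (Ordinal hm) _ _ zd6_twins)).
by apply/eqP => - [].
Qed.
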